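(* Let $s$ denote West's stack-sorting map and let $C(x)=\dfrac{1-\sqrt{1-4x}}{2x}=\sum_{n\ge 0}\frac{1}{n+1}\binom{2n}{n}x^n$ be the generating function of the Catalan numbers. Then, as formal power series, \[\sum_{n\geq 0}\bigl|s^{-1}(\operatorname{Av}_n(231,321))\bigr|\,x^n=\frac{1}{1-xC(xC(x))}.\]
   Context: A permutation is an ordering of a finite set of positive integers written in one-line notation; $S_n$ is the set of permutations of $[n]=\{1,\dots,n\}$ (with $S_0$ containing only the empty permutation). The normalization of a permutation of length $n$ is the element of $S_n$ obtained by replacing the $i$-th smallest entry by $i$ for each $i$. A permutation $\sigma=\sigma_1\cdots\sigma_n$ contains a pattern $\tau\in S_m$ if there are indices $i_1<\cdots<i_m$ such that the normalization of $\sigma_{i_1}\cdots\sigma_{i_m}$ is $\tau$; otherwise it avoids $\tau$. $\operatorname{Av}_n(\tau^{(1)},\tau^{(2)},\ldots)$ is the set of permutations in $S_n$ avoiding all listed patterns. The stack-sorting map $s$ is defined recursively: $s$ sends the empty permutation to itself, and if $\pi$ is nonempty with largest entry $m$, write $\pi=LmR$ and set $s(\pi)=s(L)\,s(R)\,m$ (concatenation). For a set $A$ of permutations, $s^{-1}(A)$ is the set of all permutations $\sigma$ with $s(\sigma)\in A$. *)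

(* Defs.v *)
From HB Require Import structures.
From mathcomp Require Import all_boot all_order all_algebra finmap.
From mathcomp Require Import zify ring lra.
From mathcomp Require Import boolp classical_sets cardinality.

Set Implicit Arguments.
Unset Strict Implicit.
Unset Printing Implicit Defensive.

Import Order.TTheory GRing.Theory Num.Theory.

Section PowerSeries.
Local Open Scope ring_scope.
Variable F : fieldType.

Record fps := Fps { fps_coef :> nat -> F }.

HB.instance Definition _ := gen_eqMixin fps.
HB.instance Definition _ := gen_choiceMixin fps.

Lemma fpsP (f g : fps) : f =1 g -> f = g.
Proof. by case: f g => [f] [g] /= /funext ->. Qed.

Definition fps_zero : fps := Fps (fun _ => 0).
Definition fps_opp (f : fps) : fps := Fps (fun n => - f n).
Definition fps_add (f g : fps) : fps := Fps (fun n => f n + g n).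
Definition fps_one : fps := Fps (fun n => (n == 0%N)%:R).
Definition fps_mul (f g : fps) : fps :=
  Fps (fun n => \sum_(i < n.+1) f i * g (n - i)%N).

Fact fps_addA : associative fps_add.
Proof. by move=> f g h; apply/fpsP => n /=; rewrite addrA. Qed.
Fact fps_addC : commutative fps_add.
Proof. by move=> f g; apply/fpsP => n /=; rewrite addrC. Qed.
Fact fps_add0 : left_id fps_zero fps_add.
Proof. by move=> f; apply/fpsP => n /=; rewrite add0r. Qed.
Fact fps_addN : left_inverse fps_zero fps_opp fps_add.
Proof. by move=> f; apply/fpsP => n /=; rewrite addNr. Qed.

HB.instance Definition _ :=
  GRing.isZmodule.Build fps fps_addA fps_addC fps_add0 fps_addN.

Definition fps_trunc (N : nat) (f : fps) : {poly F} := \poly_(i < N) f i.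

Fact fps_mul_trunc (N n : nat) (f g : fps) : (n < N)%N ->
  fps_mul f g n = (fps_trunc N f * fps_trunc N g)`_n.
Proof.
move=> ltnN; rewrite coefM; apply: eq_bigr => i _; rewrite !coef_poly.
by rewrite (leq_ltn_trans _ ltnN) ?leq_ord// (leq_ltn_trans _ ltnN)// leq_subr.
Qed.

Fact fps_mulC : commutative fps_mul.
Proof. by move=> f g; apply/fpsP => n; rewrite !(fps_mul_trunc (N := n.+1))// mulrC. Qed.

Fact fps_mulA : associative fps_mul.
Proof.
move=> f g h; apply/fpsP => n; pose t := fps_trunc n.+1.
have lt (i : 'I_n.+1) : (n - i < n.+1)%N by rewrite ltnS leq_subr.
transitivity ((t f * (t g * t h))`_n).
  rewrite coefM; apply: eq_bigr => i _; rewrite coef_poly ltn_ord.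
  by rewrite (fps_mul_trunc (N := n.+1)).
rewrite mulrA coefM; apply: eq_bigr => i _; rewrite coef_poly lt.
by rewrite (fps_mul_trunc (N := n.+1)).
Qed.

Fact fps_mul1 : left_id fps_one fps_mul.
Proof.
move=> f; apply/fpsP => n /=; rewrite big_ord_recl/= mul1r subn0 big1 ?addr0//.
by move=> i _; rewrite mul0r.
Qed.

Fact fps_mulDl : left_distributive fps_mul fps_add.
Proof.
move=> f g h; apply/fpsP => n /=; rewrite -big_split.
by apply: eq_bigr => i _; rewrite mulrDl.
Qed.

Fact fps_one_neq0 : fps_one != 0.
Proof. by apply/eqP => /(congr1 (fun f : fps => f 0%N))/eqP; rewrite oner_eq0. Qed.

HB.instance Definition _ := GRing.Zmodule_isComNzRing.Build fps
  fps_mulA fps_mulC fps_mul1 fps_mulDl fps_one_neq0.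

Definition fps_unit : {pred fps} := [pred f : fps | f 0%N != 0].

(* The first n coefficients of 1 / f, from f_0 g_n + ... + f_n g_0 = [n = 0]. *)
Fixpoint fps_inv_prefix (f : fps) (n : nat) : seq F :=
  if n is m.+1 then
    let g := fps_inv_prefix f m in
    rcons g ((f 0%N)^-1 * ((m == 0%N)%:R - \sum_(i < m) g`_i * f (m - i)%N))
  else [::].

(* As usual in MathComp, the inverse of a non-unit is itself. *)
Definition fps_inv (f : fps) : fps :=
  if f \in fps_unit then Fps (fun n => (fps_inv_prefix f n.+1)`_n) else f.

Fact size_fps_inv_prefix f n : size (fps_inv_prefix f n) = n.
Proof. by elim: n => //= n IHn; rewrite size_rcons IHn. Qed.

Fact nth_fps_inv_prefix f n i :
  (i < n)%N -> (fps_inv_prefix f n)`_i = (fps_inv_prefix f i.+1)`_i.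
Proof.
elim: n => // n IHn; rewrite ltnS leq_eqVlt => /predU1P[->//|ltin].
by rewrite [fps_inv_prefix f n.+1]/= nth_rcons size_fps_inv_prefix ltin IHn.
Qed.

Fact fps_mulVx : {in fps_unit, left_inverse 1 fps_inv *%R}.
Proof.
move=> f uf; apply/fpsP => n; rewrite /fps_inv uf.
change (\sum_(i < n.+1) (fps_inv_prefix f i.+1)`_i * f (n - i)%N = (n == 0%N)%:R).
rewrite big_ord_recr/= subnn nth_rcons size_fps_inv_prefix ltnn eqxx.
rewrite mulrAC mulVf// mul1r [X in X + _](_ : _ = \sum_(i < n)
  (fps_inv_prefix f n)`_i * f (n - i)%N) ?addrNK; last first.
  by apply: eq_bigr => i _; rewrite (nth_fps_inv_prefix _ (ltn_ord i)).
by rewrite addrC subrK.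
Qed.

Fact fps_unitPl (f g : fps) : g * f = 1 -> fps_unit f.
Proof.
move/(congr1 (fun h : fps => h 0%N)); rewrite [LHS]/= big_ord1/= => gf1.
by apply/eqP => f0; move/eqP: gf1; rewrite f0 mulr0 eq_sym oner_eq0.
Qed.

Fact fps_inv_out : {in [predC fps_unit], fps_inv =1 id}.
Proof. by move=> f /negbTE nuf; rewrite /fps_inv nuf. Qed.

HB.instance Definition _ := GRing.ComNzRing_hasMulInverse.Build fps
  fps_mulVx fps_unitPl fps_inv_out.

Definition fps_X : fps := Fps (fun n => (n == 1%N)%:R).

(* f(g(x)); only meaningful when g has zero constant term, in which case g ^+ k
   does not contribute to the coefficient of x^n for k > n. *)
Definition fps_comp (f g : fps) : fps :=
  Fps (fun n => \sum_(k < n.+1) f k * (g ^+ k) n).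

End PowerSeries.

Arguments fps_X {F}.

Section Catalan.
Local Open Scope ring_scope.

Definition catalan_gf : fps rat := Fps (fun n => 'C(n.*2, n)%:R / n.+1%:R).

Fact central_bin_rec n :
  (n.+1 * 'C(n.+1.*2, n.+1) = n.*2.+1.*2 * 'C(n.*2, n))%N.
Proof.
have := mul_bin_down n.*2.+1 n; have := mul_bin_diag n.+1.*2 n; rewrite /=.
have -> : (n.*2.+1 - n = n.+1)%N by lia.
move=> <- e; rewrite -[in RHS]doubleMl e doubleMl; lia.
Qed.

Fact catalan_gf_rec n :
  n.+2%:R * catalan_gf n.+1 = (4 * n%:R + 2) * catalan_gf n.
Proof.
have /(congr1 (fun k => k%:R : rat)) := central_bin_rec n.
rewrite /= !natrM => eqb.
have n1 : n.+1%:R != 0 :> rat by rewrite pnatr_eq0.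
rewrite [LHS]mulrC divfK ?pnatr_eq0//; apply: (mulfI n1).
rewrite eqb [RHS]mulrCA [n.+1%:R * _]mulrC divfK//; congr (_ * _).
by rewrite -natrM -natrD; congr (_%:R); lia.
Qed.

(* C = (1 - sqrt (1 - 4x)) / (2x), the square root being the one with constant
   term 1. *)
Lemma catalan_gf_sqrt :
  (1 - 2 * fps_X * catalan_gf) ^+ 2 = 1 - 4 * fps_X :> fps rat.
Proof.
set f := 1 - _; pose h := f ^+ 2.
have coefXM (g : fps rat) n : (fps_X * g) n.+1 = g n.
  rewrite [LHS]/= 2!big_ord_recl/= mul0r add0r mul1r subSS subn0 big1 ?addr0//.
  by move=> i _; rewrite mul0r.
have coefMn (g : fps rat) k n : (k%:R * g) n = k%:R * g n.
  rewrite !mulr_natl; elim: k => [|k IHk]; first by rewrite !mulr0n.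
  by rewrite !mulrSr -IHk.
have coefB (a b : fps rat) n : (a - b) n = a n - b n by [].
have fE : f = 1 - 2 * (fps_X * catalan_gf) by rewrite mulrA.
have f0 : f 0%N = 1.
  by rewrite fE coefB coefMn/= big_ord1/= mul0r mulr0 subr0.
have fS n : f n.+1 = - 2 * catalan_gf n.
  by rewrite fE coefB coefMn coefXM/= sub0r mulNr.
have frec n : n.+1%:R * f n.+1 = (4 * n%:R - 2) * f n.
  case: n => [|n]; first by rewrite fS f0 /= bin0 divr1; ring.
  rewrite !fS mulrCA catalan_gf_rec -[in RHS]natr1; ring.
have hE n : h n = \sum_(i < n.+1) f i * f (n - i)%N by rewrite /h expr2.
rewrite -/h; clearbody h; clear fE; clearbody f.
have wE n : n%:R * h n = 2 * \sum_(i < n.+1) i%:R * f i * f (n - i)%N.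
  transitivity (\sum_(i < n.+1) i%:R * f i * f (n - i)%N +
                \sum_(i < n.+1) (n - i)%:R * f i * f (n - i)%N).
    rewrite hE mulr_sumr -big_split; apply: eq_bigr => i _ /=.
    by rewrite -mulrDl -mulrDl -natrD subnKC ?leq_ord// mulrA.
  rewrite [X in _ + X](reindex_inj rev_ord_inj) /= mulr2n mulrDl mul1r.
  congr (_ + _); apply: eq_bigr => i _; rewrite subSS subKn ?leq_ord//.
  by rewrite mulrAC.
have hrec n : n.+1%:R * h n.+1 = (4 * n%:R - 4) * h n.
  rewrite wE big_ord_recl !mul0r add0r.
  transitivity (2 * \sum_(i < n.+1) (4 * (i%:R * f i * f (n - i)%N)
                                     - 2 * (f i * f (n - i)%N))).
    congr (_ * _); apply: eq_bigr => i _; rewrite lift0 subSS frec; ring.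
  by rewrite sumrB -!mulr_sumr -hE mulrBr mulrCA -wE; ring.
apply/fpsP => n; rewrite coefB coefMn.
have h0 : h 0%N = 1 by rewrite hE big_ord1 f0 mulr1.
case: n => [|[|n]]; rewrite /= ?mulr0 ?subr0//.
  by have := hrec 0%N; rewrite h0; lra.
elim: n => [|n IHn].
  by have := hrec 1%N; lra.
apply/eqP; move: (hrec n.+2); rewrite IHn mulr0 => /eqP.
by rewrite mulf_eq0 pnatr_eq0.
Qed.

End Catalan.

Local Open Scope nat_scope.
Local Open Scope classical_set_scope.

Definition is_permutation (w : seq nat) : bool := uniq w && (0 \notin w).

Definition Sym_words (n : nat) : set (seq nat) :=
  [set w | perm_eq w (iota 1 n)].

Definition normalize (w : seq nat) : seq nat :=
  [seq (index x (sort leq w)).+1 | x <- w].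

Definition contains (w t : seq nat) : Prop :=
  exists2 u, subseq u w & normalize u = t.

Definition Av (n : nat) (ts : seq (seq nat)) : set (seq nat) :=
  [set w | Sym_words n w /\ forall t, t \in ts -> ~ contains w t].

(* The first argument is fuel for the recursion; size w is enough. *)
Fixpoint stack_sort_rec (k : nat) (w : seq nat) : seq nat :=
  if k is k'.+1 then
    if w is [::] then [::] else
    let m := \max_(x <- w) x in
    let i := index m w in
    stack_sort_rec k' (take i w) ++ stack_sort_rec k' (drop i.+1 w) ++ [:: m]
  else [::].

Definition stack_sort (w : seq nat) : seq nat := stack_sort_rec (size w) w.

Definition stack_sort_preimage (A : set (seq nat)) : set (seq nat) :=
  [set w | is_permutation w /\ A (stack_sort w)].

Fact max_mem (w : seq nat) : w != [::] -> \max_(x <- w) x \in w.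
Proof.
elim: w => // x [|y w] IHw _; first by rewrite big_seq1 mem_head.
rewrite big_cons inE; have := IHw isT; move: (\max_(j <- _) j) => m mw.
by rewrite maxnE -maxnE /maxn; case: ifP => _; rewrite ?mw ?eqxx ?orbT.
Qed.

Fact stack_sort_rec_fuel k w : size w <= k -> stack_sort_rec k w = stack_sort w.
Proof.
rewrite /stack_sort; have [n] := ubnP (size w); elim: n k w => // n IHn.
move=> [|k] [|x w]//= lewn lewk; set m := \max_(_ <- _) _; set v := x :: w.
have imv : index m v < size v by rewrite index_mem max_mem.
have lt1 : size (take (index m v) v) <= size w by rewrite size_take imv -ltnS.
have lt2 : size (drop (index m v) w) <= size w by rewrite size_drop leq_subr.
congr (_ ++ (_ ++ _)).
  by rewrite [LHS]IHn ?[RHS]IHn// ?(leq_ltn_trans lt1)// (leq_trans lt1).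
by rewrite [LHS]IHn ?[RHS]IHn// ?(leq_ltn_trans lt2)// (leq_trans lt2).
Qed.

Lemma stack_sort_nil : stack_sort [::] = [::].
Proof. by []. Qed.

Lemma stack_sort_cat (L R : seq nat) (m : nat) :
  all (fun x => x < m) (L ++ R) ->
  stack_sort (L ++ m :: R) = stack_sort L ++ stack_sort R ++ [:: m].
Proof.
rewrite all_cat => /andP[/allP Lm /allP Rm].
have mE : \max_(x <- L ++ m :: R) x = m.
  apply/eqP; rewrite eqn_leq big_cat big_cons/= !geq_max leqnn/=.
  rewrite !leq_max leqnn orbT andbT.
  by apply/andP; split; apply/bigmax_leqP_seq => x xin _; apply: ltnW; auto.
have iE : index m (L ++ m :: R) = size L.
  rewrite index_cat /= eqxx addn0 ifN//.
  by apply/negP => /Lm; rewrite ltnn.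
rewrite {1}/stack_sort size_cat /= addnS.
have -> k : stack_sort_rec k.+1 (L ++ m :: R) =
    stack_sort_rec k L ++ stack_sort_rec k R ++ [:: m].
  rewrite [LHS]/= mE iE take_size_cat// -cat_rcons drop_size_cat ?size_rcons//.
  by case: L {Lm mE iE}.
by rewrite !stack_sort_rec_fuel ?leq_addr ?leq_addl.
Qed.

Lemma perm_stack_sort (w : seq nat) : perm_eq (stack_sort w) w.
Proof.
suff H k : size w <= k -> perm_eq (stack_sort_rec k w) w by exact: H.
elim: k w => [|k IHk] [|x w]// lewk.
rewrite [stack_sort_rec _ _]/=; set m := \max_(_ <- _) _; set v := x :: w.
have mv : m \in v by rewrite max_mem.
have imv : index m v < size v by rewrite index_mem.
have p1 := IHk (take (index m v) v); have p2 := IHk (drop (index m v).+1 v).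
have /p1/permPl e1 : size (take (index m v) v) <= k.
  by rewrite size_take imv -ltnS (leq_trans imv).
have /p2/permPl e2 : size (drop (index m v).+1 v) <= k.
  by rewrite size_drop leq_subLR (leq_trans lewk)// addSn ltnS leq_addl.
have vE : v = take (index m v) v ++ m :: drop (index m v).+1 v.
  by rewrite -[X in _ :: drop _ X]/v -{2}(nth_index 0 mv) -drop_nth// cat_take_drop.
rewrite [X in perm_eq _ X]vE.
apply/permP => a; move/permP: (permEl e1) => /(_ a); move/permP: (permEl e2) => /(_ a).
by rewrite !count_cat /= => -> ->; rewrite addn0 [count a _ + a m]addnC.
Qed.

Lemma finite_stack_sort_preimage n ts :
  finite_set (stack_sort_preimage (Av n ts)).
Proof.
apply: (@sub_finite_set _ _ [set` permutations (iota 1 n)]); last exact: finite_seq.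
move=> w [_ [wn _]] /=; rewrite mem_permutations.
by rewrite -(permPr wn) perm_sym perm_stack_sort.
Qed.

(* Main.v *)
(* A permutation avoids 231 and 321 iff each entry has at most one larger entry
   before it.  Write a preimage as L m R with m maximal.  Either L < R, or
   exactly one entry l = max L exceeds entries of R; then the j entries of R
   below l must open s(R) as 1 2 ... j.  So the preimage is determined by
   normalized L, R and j, where 0 <= j <= p(R) if L is nonempty, j = 0
   otherwise, and p(w) is the number of leading fixed points of s(w).
   Let f count the preimages, let h count them with weight 1 + p, and let c
   count the permutations sorted by s.  Tracking p through the decomposition
   gives
     c = 1 + x c^2,   h = c + x h^2,   f = 1 + x (f h + f - h).
   Hence c = C.  With G = C(x C) = 1 + x C G^2 the second equation gives h = C G,
   and the third one then gives f (1 - x G) = 1. *)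
Require Import Defs.
From mathcomp Require Import all_boot all_order all_algebra finmap.
From mathcomp Require Import zify ring lra.
From mathcomp Require Import boolp classical_sets cardinality.

Set Implicit Arguments.
Unset Strict Implicit.
Unset Printing Implicit Defensive.

Import GRing.Theory.

Local Open Scope nat_scope.

(** * Avoidance of 231 and 321 *)

Definition good (v : seq nat) : bool :=
  all (fun i => count (ltn (nth 0 v i)) (take i v) <= 1) (iota 0 (size v)).

Lemma goodP (v : seq nat) :
  reflect (forall u z t, v = u ++ z :: t -> count (ltn z) u <= 1) (good v).
Proof.
apply: (iffP allP) => [H u z t vE|H i].
  have := H (size u); rewrite mem_iota vE size_cat /= nth_cat ltnn subnn /=.
  by rewrite take_size_cat //; apply; lia.
rewrite mem_iota add0n => /andP[_ iv].
by apply: (H _ _ (drop i.+1 v)); rewrite -drop_nth ?cat_take_drop.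
Qed.

Lemma good_catl (u v : seq nat) : good (u ++ v) -> good u.
Proof.
move=> /goodP H; apply/goodP => a z b uE.
by apply: (H a z (b ++ v)); rewrite uE -catA.
Qed.

Lemma good_catr (u v : seq nat) : good (u ++ v) -> good v.
Proof.
move=> /goodP H; apply/goodP => a z b vE.
have := H (u ++ a) z b; rewrite vE catA count_cat => /(_ erefl).
by apply: leq_trans; apply: leq_addl.
Qed.

Lemma good_map (f : nat -> nat) (v : seq nat) :
  {mono f : x y / x < y} -> good (map f v) = good v.
Proof.
move=> fm; rewrite /good size_map; apply: eq_in_all => i.
rewrite mem_iota add0n => /andP[_ iv].
by rewrite (nth_map 0) // -map_take count_map; congr (_ <= _); apply: eq_count => x /=.
Qed.

Lemma good_rcons_max (v : seq nat) (m : nat) :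
  all (fun x => x < m) v -> good (v ++ [:: m]) = good v.
Proof.
move=> vm; rewrite /good size_cat /= addn1 -[(size v).+1]addn1 iotaD all_cat /= add0n.
rewrite nth_cat ltnn subnn take_size_cat // andbT.
have -> : count (ltn (nth 0 [:: m] 0)) v = 0.
  apply/eqP; rewrite -leqn0 leqNgt -has_count; apply/hasPn => x xv /=.
  by have := allP vm _ xv; lia.
rewrite andbT; apply: eq_in_all => i; rewrite mem_iota add0n => /andP[_ iv].
by rewrite nth_cat iv takel_cat // ltnW.
Qed.

Lemma normalize_eq3 (x y z : nat) : uniq [:: x; y; z] ->
  (normalize [:: x; y; z] \in [:: [:: 2; 3; 1]; [:: 3; 2; 1]]) = (z < x) && (z < y).
Proof.
move=> U; rewrite /normalize.
(* Spelling out the sorted list for each of the six relative orders lets [normalize] compute. *)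
have sE : sort leq [:: x; y; z] =
   if x < y then if y < z then [:: x; y; z] else if x < z then [:: x; z; y] else [:: z; x; y]
   else if x < z then [:: y; x; z] else if y < z then [:: y; z; x] else [:: z; y; x].
  apply: (sorted_eq leq_trans anti_leq).
  - exact: (sort_sorted leq_total).
  - by repeat case: ltnP => ?; rewrite /=; lia.
  - rewrite perm_sort.
    move: U; rewrite /= !inE => U.
    by repeat case: ltnP => ?; apply/permP => P /=; lia.
rewrite sE; move: U; rewrite /= !inE => U.
have [xy [xz yz]] : (x == y) = false /\ (x == z) = false /\ (y == z) = false by lia.
by repeat case: ltnP => ?;
  rewrite /= ?eqxx ?(eq_sym z x) ?(eq_sym z y) ?(eq_sym y x) ?xy ?xz ?yz /= ?inE ?eqE /=; lia.
Qed.

(** The final [z] must be matched at the displayed [z] or earlier, so everything before it embeds in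
    [u]. *)
Lemma subseq_rcons_split (T : eqType) (z : T) (s u r : seq T) : z \notin r ->
  subseq (rcons s z) (u ++ z :: r) -> subseq s u.
Proof.
move=> zr; elim: u s => [|b u IHu] [|a s] //=.
- case: ifP => _ /mem_subseq/(_ z); rewrite ?inE mem_rcons inE eqxx ?orbT (negbTE zr);
    by move=> /(_ isT).
- by case: ifP => _; [apply: IHu | apply: (IHu (a :: s))].
Qed.

(** The patterns 231 and 321 are the two arrangements of three values with the smallest one last. An
    occurrence of either is therefore an entry preceded by two larger ones, in whatever order. *)
Lemma Av_good (n : nat) (v : seq nat) : perm_eq v (iota 1 n) ->
  Av n [:: [:: 2; 3; 1]; [:: 3; 2; 1]] v <-> good v.
Proof.
move=> vn; have uv : uniq v by rewrite (perm_uniq vn) iota_uniq.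
split=> [[_ H]|/goodP H].
  apply/goodP => u z t vE; rewrite leqNgt; apply/negP; rewrite -size_filter => c2.
  case E: [seq x <- u | ltn z x] c2 => [|x [|y s]] // _.
  have xyz : subseq [:: x; y; z] v.
    rewrite vE -[[:: x; y; z]]/([:: x; y] ++ [:: z]); apply: cat_subseq.
      apply: subseq_trans (filter_subseq (ltn z) u).
      by rewrite E (prefix_subseq [:: x; y] s).
    by rewrite (prefix_subseq [:: z] t).
  have zxy : (z < x) && (z < y).
    have := mem_filter (ltn z) x u; have := mem_filter (ltn z) y u.
    by rewrite E !inE !eqxx ?orbT => /esym/andP[/= -> _] /esym/andP[/= -> _].
  have := normalize_eq3 (subseq_uniq xyz uv); rewrite zxy => tin.
  by apply: (H _ tin); exists [:: x; y; z].
split=> // t tin [w wv wt].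
have : size w = 3.
  rewrite -(size_map (fun x => (index x (sort leq w)).+1) w) -/(normalize w) wt.
  by move: tin; rewrite !inE => /orP[]/eqP->.
case: w wv wt => [|x [|y [|z []]]] // wv wt _.
move: tin; rewrite -wt normalize_eq3 ?(subseq_uniq wv uv) // => /andP[zx zy].
have zv : z \in v by apply: (mem_subseq wv); rewrite !inE eqxx !orbT.
case/splitPr: zv wv uv H {vn} => u r wv uv H.
have zr : z \notin r by move: uv; rewrite cat_uniq /= => /and3P[_ _ /andP[]].
have xyu : subseq [:: x; y] u by exact: (@subseq_rcons_split _ z [:: x; y] _ _ zr).
have := H _ _ _ erefl; rewrite leqNgt => /negP; apply.
by apply: leq_trans (leq_count_subseq (ltn z) xyu); rewrite /= zx zy.
Qed.

Lemma split_max (w : seq nat) : uniq w -> w != [::] ->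
  exists L m R, w = L ++ m :: R /\ all (fun x => x < m) (L ++ R).
Proof.
move=> uw w0; set m := \max_(x <- w) x.
have mw : m \in w by exact: max_mem.
have lem x : x \in w -> x <= m by move=> xw; rewrite /m (big_rem x) //= leq_maxl.
clearbody m; case/splitPr: mw uw lem {w0} => L R uw lem; exists L, m, R; split=> //.
apply/allP => x xLR; rewrite ltn_neqAle lem ?andbT; last first.
  by move: xLR; rewrite !mem_cat inE => /orP[]->; rewrite ?orbT.
move: uw; rewrite -cat_rcons -cats1 -catA uniq_catCA /= => /andP[mn _].
by apply: contra mn => /eqP <-.
Qed.

(** Stack-sorting depends only on relative order: an increasing [f] preserves the position of the
    maximum, and induction handles both sides of it. *)
Lemma stack_sort_map (f : nat -> nat) (w : seq nat) :
  {mono f : x y / x < y} -> uniq w -> stack_sort (map f w) = map f (stack_sort w).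
Proof.
move=> fm; have [n] := ubnP (size w); elim: n w => // n IHn w sw uw.
have [->//|w0] := eqVneq w [::].
have [L [m [R [wE lt]]]] := split_max uw w0.
move: sw uw; rewrite wE size_cat cat_uniq /= => sw /and3P[uL _ /andP[_ uR]].
rewrite map_cat /= !stack_sort_cat //; last first.
  rewrite -map_cat all_map; apply: sub_all lt => x /=; by rewrite fm.
by rewrite !map_cat /= !IHn //; lia.
Qed.

(** * Splitting a preimage at its largest entry *)

Fixpoint fix_run (k : nat) (v : seq nat) : nat :=
  if v is x :: v' then if x == k then (fix_run k.+1 v').+1 else 0 else 0.

Lemma fix_run_iota (k j : nat) (v : seq nat) :
  (j <= fix_run k v) = prefix (iota k j) v.
Proof.
elim: v k j => [|x v IHv] k [|j]; rewrite ?prefix0s //=.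
by rewrite (eq_sym k); case: eqP => //= _; rewrite ltnS IHv.
Qed.

Lemma fix_run_size (k : nat) (v : seq nat) : fix_run k v <= size v.
Proof. by elim: v k => //= x v IHv k; case: ifP => // _; rewrite ltnS. Qed.

Lemma fix_run_cat (k : nat) (u v : seq nat) :
  fix_run k (u ++ v) =
  if fix_run k u == size u then size u + fix_run (k + size u) v else fix_run k u.
Proof.
elim: u k => [|x u IHu] k /=; first by rewrite addn0.
case: eqP => // _; rewrite IHu eqSS; case: ifP => // _.
by rewrite addSn -addSnnS.
Qed.

Lemma fix_run_addn (a k : nat) (v : seq nat) :
  fix_run (a + k) (map (addn a) v) = fix_run k v.
Proof. by elim: v k => //= x v IHv k; rewrite eqn_add2l -addnS IHv. Qed.

(** By pigeonhole, [n] distinct values between 1 and [n] exhaust that interval. *)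
Lemma perm_iotaP (n : nat) (w : seq nat) :
  reflect [/\ uniq w, size w = n & {in w, forall x, 0 < x <= n}] (perm_eq w (iota 1 n)).
Proof.
apply: (iffP idP) => [wn|[uw sw wn]].
  split; rewrite ?(perm_uniq wn) ?iota_uniq ?(perm_size wn) ?size_iota // => x.
  by rewrite (perm_mem wn) mem_iota add1n.
apply: uniq_perm; rewrite ?iota_uniq //.
have [||_ e] // := uniq_min_size uw (_ : {subset w <= iota 1 n}).
- by move=> x /wn; rewrite mem_iota add1n.
- by rewrite size_iota sw.
Qed.

(* In a permutation [L' m R'] with maximum [m], whose image [s(L') s(R') m] is
   good, an entry of [R'] is below at most one entry of [L'], necessarily
   [l = max L'].  With [a] the size of [L'] and [j] the number of entries of
   [R'] below [l], the values in [L'] are [1, ..., a - 1] and [l = a + j]. *)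
Definition left_relabel (a j x : nat) : nat := if x < a then x else x + j.

Definition right_relabel (a j x : nat) : nat := if x <= j then (x + a).-1 else x + a.

Definition join (L R : seq nat) (j : nat) : seq nat :=
  map (left_relabel (size L) j) L ++ (size L + size R).+1 :: map (right_relabel (size L) j) R.

Definition preimages (n : nat) : seq (seq nat) :=
  [seq w <- permutations (iota 1 n) | good (stack_sort w)].

Definition lead (w : seq nat) : nat := fix_run 1 (stack_sort w).

Lemma mem_preimages (n : nat) (w : seq nat) :
  w \in preimages n = perm_eq w (iota 1 n) && good (stack_sort w).
Proof. by rewrite mem_filter mem_permutations andbC. Qed.

Lemma left_relabel_mono (a j : nat) : {mono left_relabel a j : x y / x < y}.
Proof. by move=> x y; rewrite /left_relabel; case: ifP; case: ifP; lia. Qed.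

(** For [a = 0] and [j > 0] the truncated predecessor would send both 0 and 1 to 0. *)
Lemma right_relabel_mono (a j : nat) : (0 < a) || (j == 0) ->
  {mono right_relabel a j : x y / x < y}.
Proof. by move=> aj x y; rewrite /right_relabel; case: ifP; case: ifP; lia. Qed.

Lemma mono_ltn_inj (f : nat -> nat) : {mono f : x y / x < y} -> injective f.
Proof.
by move=> fm x y fxy; have := fm x y; have := fm y x; rewrite fxy ltnn; lia.
Qed.

Lemma iota1_rcons (n : nat) : iota 1 n.+1 = rcons (iota 1 n) n.+1.
Proof. by rewrite -[in LHS](addn1 n) iotaD add1n cats1. Qed.

Lemma perm_iotaS_mid (n : nat) (u v : seq nat) :
  perm_eq (u ++ n.+1 :: v) (iota 1 n.+1) = perm_eq (u ++ v) (iota 1 n).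
Proof.
by rewrite iota1_rcons perm_sym perm_rcons perm_sym -cat1s perm_catCA perm_cons. Qed.

Lemma stack_sort_last (n : nat) (w : seq nat) : perm_eq w (iota 1 n.+1) ->
  exists2 u, stack_sort w = u ++ [:: n.+1] & perm_eq u (iota 1 n).
Proof.
move=> wn; have /perm_iotaP[uw sw wb] := wn.
have mw : n.+1 \in w by rewrite (perm_mem wn) mem_iota; lia.
case/splitPr: mw wn uw sw wb => L R wn uw sw wb.
have LRn : perm_eq (L ++ R) (iota 1 n) by rewrite -perm_iotaS_mid.
have lt : all (fun x => x < n.+1) (L ++ R).
  by apply/allP => x; rewrite (perm_mem LRn) mem_iota; lia.
exists (stack_sort L ++ stack_sort R); first by rewrite stack_sort_cat // catA.
by apply: perm_trans LRn; apply: perm_cat; apply: perm_stack_sort.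
Qed.

Lemma good_cat (u v : seq nat) :
  good (u ++ v) = good u &&
    all (fun k => count (ltn (nth 0 v k)) (u ++ take k v) <= 1) (iota 0 (size v)).
Proof.
rewrite {1}/good size_cat iotaD all_cat add0n; congr (_ && _).
  apply: eq_in_all => i; rewrite mem_iota add0n => /andP[_ iu].
  by rewrite nth_cat iu takel_cat // ltnW.
rewrite -[X in iota X _]addn0 iotaDl all_map; apply: eq_all => k /=.
by rewrite nth_cat ltnNge leq_addr addKn take_cat ltnNge leq_addr addKn.
Qed.

Lemma preimagesP (n : nat) (w : seq nat) :
  reflect (perm_eq w (iota 1 n) /\ good (stack_sort w)) (w \in preimages n).
Proof. by rewrite mem_preimages; exact: andP. Qed.

Lemma size_preimages (n : nat) (w : seq nat) : w \in preimages n -> size w = n.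
Proof. by case/preimagesP => /perm_iotaP[]. Qed.

Lemma stack_sort_iota (n : nat) (w : seq nat) :
  perm_eq w (iota 1 n) -> perm_eq (stack_sort w) (iota 1 n).
Proof. exact: perm_trans (perm_stack_sort w). Qed.

Lemma lead_leq (w : seq nat) : lead w <= size w.
Proof. by rewrite -(perm_size (perm_stack_sort w)) fix_run_size. Qed.

(* Entries below [l] already have [l] as a larger predecessor, so the [j]
   smallest entries of [s(R)] must form its initial segment [1 2 ... j]. *)
Definition max_jump (L R : seq nat) : nat := if L is [::] then 0 else lead R.

Lemma max_jump_leq (L R : seq nat) : max_jump L R <= size R.
Proof. by case: L => // x L; exact: lead_leq. Qed.

Lemma max_jump_cond (L R : seq nat) (j : nat) :
  j <= max_jump L R -> (0 < size L) || (j == 0).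
Proof. by case: L => //=; rewrite leqn0. Qed.

(** * Joining two blocks yields a preimage *)

Section Join.

Variables (a b : nat) (L R : seq nat) (j : nat).
Hypotheses (La : perm_eq L (iota 1 a)) (Rb : perm_eq R (iota 1 b)).
Hypothesis (jLR : j <= max_jump L R).

Let sL : size L = a. Proof. by have /perm_iotaP[] := La. Qed.
Let sR : size R = b. Proof. by have /perm_iotaP[] := Rb. Qed.
Let jb : j <= b. Proof. by rewrite -sR (leq_trans jLR) ?max_jump_leq. Qed.
Let aj : (0 < a) || (j == 0). Proof. by rewrite -sL (max_jump_cond jLR). Qed.

(** For [a > 0] the right block takes the values a, ..., a + j - 1 and a + j + 1, ..., a + b,
    exactly those that the left block leaves free. *)
Lemma perm_relabel :
  perm_eq (map (left_relabel a j) L ++ map (right_relabel a j) R) (iota 1 (a + b)).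
Proof.
have /perm_iotaP[uL _ bL] := La; have /perm_iotaP[uR _ bR] := Rb.
have jb' := jb; have aj' := aj.
apply/perm_iotaP; split.
- rewrite cat_uniq !map_inj_uniq ?uL ?uR ?andbT /=; last 2 first.
  + exact: mono_ltn_inj (right_relabel_mono aj).
  + exact: mono_ltn_inj (left_relabel_mono a j).
  apply/hasPn => _ /mapP[y yR ->]; apply/negP => /mapP[x xL].
  have := bL _ xL; have := bR _ yR; rewrite /left_relabel /right_relabel.
  by case: ifP; case: ifP; lia.
- by rewrite size_cat !size_map sL sR.
- move=> z; rewrite mem_cat => /orP[]/mapP[x xL ->].
    by have := bL _ xL; rewrite /left_relabel; case: ifP; lia.
  by have := bR _ xL; rewrite /right_relabel; case: ifP; lia.
Qed.

Lemma stack_sort_join :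
  stack_sort (join L R j) =
  map (left_relabel a j) (stack_sort L) ++
  map (right_relabel a j) (stack_sort R) ++ [:: (a + b).+1].
Proof.
have /perm_iotaP[uL _ bL] := La; have /perm_iotaP[uR _ bR] := Rb.
rewrite /join sL sR stack_sort_cat; last first.
  by apply/allP => x; rewrite (perm_mem perm_relabel) mem_iota; lia.
rewrite !stack_sort_map //; first exact: right_relabel_mono.
exact: left_relabel_mono.
Qed.

Lemma perm_join : perm_eq (join L R j) (iota 1 (a + b).+1).
Proof. by rewrite /join sL sR perm_iotaS_mid perm_relabel. Qed.

(** Left entries keep the relative order they have in [stack_sort L]. A right entry with label above
    [j] exceeds the whole left block, so only [stack_sort R] matters. A right entry with label at
    most [j] is below just one left value, a + j, and has no larger entry before it in
    [stack_sort R], which opens with 1 2 ... j. *)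
Lemma good_join : good (stack_sort L) -> good (stack_sort R) ->
  good (stack_sort (join L R j)).
Proof.
move=> gL gR; have /perm_iotaP[uL _ bL] := stack_sort_iota La.
have /perm_iotaP[uR sR' bR] := stack_sort_iota Rb.
rewrite stack_sort_join catA good_rcons_max; last first.
  apply/allP => x; rewrite (perm_mem (_ : perm_eq _ (iota 1 (a + b)))).
    by rewrite mem_iota; lia.
  apply: perm_trans perm_relabel.
  by apply: perm_cat; apply: perm_map; exact: perm_stack_sort.
rewrite good_cat good_map ?gL; last exact: left_relabel_mono.
apply/allP => k; rewrite mem_iota add0n size_map => /andP[_ kR].
rewrite (nth_map 0) // -map_take count_cat !count_map.
set r := nth 0 _ k; have rR : r \in stack_sort R by exact: mem_nth.
have -> : count (preim (right_relabel a j) (ltn (right_relabel a j r)))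
    (take k (stack_sort R)) = count (ltn r) (take k (stack_sort R)).
  by apply: eq_count => x /=; rewrite right_relabel_mono.
have [rj|jr] := leqP r j; last first.
  rewrite -[X in _ <= X]add0n leq_add //; last first.
    by move/goodP: gR => /(_ _ _ (drop k.+1 (stack_sort R))); apply;
      rewrite /r -drop_nth ?cat_take_drop.
  rewrite leqNgt -has_count; apply/hasPn => x xL /=.
  have := bL _ xL; have := bR _ rR; rewrite /left_relabel /right_relabel.
  by case: ifP; case: ifP; lia.
rewrite -[X in _ <= X]addn0 leq_add //.
  apply: leq_trans (_ : count (pred1 a) (stack_sort L) <= 1); last first.
    by rewrite count_uniq_mem // leq_b1.
  rewrite -!size_filter; apply/uniq_leq_size; first exact: filter_uniq.
  move=> x; rewrite !mem_filter /= => /andP[rx xL]; rewrite xL andbT; move: rx.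
  have := bL _ xL; have := bR _ rR; rewrite /left_relabel /right_relabel rj.
  by case: ifP; lia.
have r0 : 0 < r by have := bR _ rR; lia.
have j0 : 0 < j by lia.
have jR : j <= lead R by move: jLR j0; rewrite /max_jump; case: (L) => // *; lia.
move: jR; rewrite /lead fix_run_iota => /prefixP[t RE].
(* The value [r] already occurs in the prefix 1 ... j; at a position [k >= j] it would be repeated
   in the tail [t]. *)
have kj : k < j.
  rewrite ltnNge; apply/negP => jk; move: uR; rewrite RE cat_uniq => /and3P[_ + _].
  move=> /hasPn/(_ r) /=; rewrite mem_iota add1n ltnS r0 rj => H; suff /H : r \in t by [].
  rewrite /r RE nth_cat size_iota ltnNge jk /=; apply: mem_nth.
  by rewrite -(ltn_add2l j) subnKC // -[X in X + _](size_iota 1 j) -size_cat -RE.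
rewrite /r RE nth_cat size_iota kj nth_iota // takel_cat ?size_iota; last exact: ltnW.
rewrite leqNgt -has_count; apply/hasPn => x; rewrite take_iota mem_iota /=.
by lia.
Qed.

End Join.

(** If [L] is not sorted, the run already breaks inside the left block. If [L] is sorted and
    [j = 0], the run passes through it, continues into the shifted right block, and gains the final
    maximum when [R] is sorted too. If [L] is sorted and [j > 0], the last left entry becomes a + j
    and stops the run after a - 1 entries. *)
Lemma lead_join (a b : nat) (L R : seq nat) (j : nat) :
  perm_eq L (iota 1 a) -> perm_eq R (iota 1 b) -> j <= max_jump L R ->
  lead (join L R j) =
  if lead L == a then
    if j == 0 then a + lead R + (lead R == b) else a.-1
  else lead L.
Proof.
move=> La Rb jLR; rewrite /lead (stack_sort_join La Rb jLR).
have /perm_iotaP[_ sL bL] := stack_sort_iota La.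
have /perm_iotaP[_ sR bR] := stack_sort_iota Rb.
have [->|j0] := eqVneq j 0.
  rewrite [map _ (stack_sort L)](_ : _ = stack_sort L); last first.
    by rewrite -[RHS]map_id; apply: eq_map => x; rewrite /left_relabel addn0 if_same.
  rewrite [map _ (stack_sort R)](_ : _ = map (addn a) (stack_sort R)); last first.
    apply/eq_in_map => x /bR; rewrite /right_relabel; case: ifP; lia.
  rewrite fix_run_cat sL; case: eqP => // _.
  rewrite fix_run_cat size_map sR (addnC 1 a) fix_run_addn.
  case: eqP => [->|_]; rewrite /= ?addn0; last by lia.
  by rewrite [X in if X then _ else _](_ : _ = true) ?eqE /=; lia.
have := max_jump_cond jLR; rewrite (negbTE j0) orbF -(perm_size (perm_stack_sort L)) sL.
case: a La sL bL => // a La sL bL _.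
have [u LE ua] := stack_sort_last La.
have /perm_iotaP[_ su bu] := ua.
rewrite LE map_cat (_ : map _ u = u); last first.
  rewrite -[RHS]map_id; apply/eq_in_map => x /bu; rewrite /left_relabel.
  by case: ifP => //=; lia.
rewrite -catA !fix_run_cat su /= /left_relabel ltnn /=.
have := fix_run_size 1 u; rewrite su => ru.
(* Here the left block has size [a.+1]; its last sorted entry, relabelled to [a.+1 + j], misses the
   expected value since [j] is positive. *)
have -> : (a.+1 + j == 1 + a) = false by lia.
case: eqP => [_|ne]; last by case: eqP; lia.
by rewrite (add1n a) eqxx (addn1 a) eqxx /= addn0.
Qed.

(** * Uniqueness and existence of the decomposition *)

Lemma cat_cons_inj (T : eqType) (m : T) (u v u' v' : seq T) :
  m \notin u -> m \notin u' -> u ++ m :: v = u' ++ m :: v' -> u = u' /\ v = v'.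
Proof.
move=> mu mu' e; have := congr1 (index m) e.
rewrite !index_cat (negbTE mu) (negbTE mu') /= eqxx !addn0 => su.
by move/eqP: e; rewrite eqseq_cat // eqseq_cons eqxx => /andP[/eqP -> /eqP ->].
Qed.

(** The maximum separates the two relabelled blocks, and the left one has size [a]. Its only value
    not below [a] is a + j, which reveals [j]; the relabellings are then cancelled by
    injectivity. *)
Lemma join_inj (a b a' b' : nat) (L R L' R' : seq nat) (j j' : nat) :
  perm_eq L (iota 1 a) -> perm_eq R (iota 1 b) -> j <= max_jump L R ->
  perm_eq L' (iota 1 a') -> perm_eq R' (iota 1 b') -> j' <= max_jump L' R' ->
  a + b = a' + b' -> join L R j = join L' R' j' -> [/\ L = L', R = R' & j = j'].
Proof.
move=> La Rb jLR La' Rb' jLR' eab.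
have lt x : (x \in map (left_relabel a j) L ++ map (right_relabel a j) R) -> x < (a + b).+1.
  by rewrite (perm_mem (perm_relabel La Rb jLR)) mem_iota; lia.
have lt' x : (x \in map (left_relabel a' j') L' ++ map (right_relabel a' j') R') ->
    x < (a' + b').+1.
  by rewrite (perm_mem (perm_relabel La' Rb' jLR')) mem_iota; lia.
have /perm_iotaP[uL sL bL] := La; have /perm_iotaP[_ sR bR] := Rb.
have /perm_iotaP[uL' sL' bL'] := La'; have /perm_iotaP[_ sR' bR'] := Rb'.
rewrite /join sL sR sL' sR' -eab => /cat_cons_inj[].
- by apply/negP => H; have := lt (a + b).+1; rewrite mem_cat H ltnn => /(_ isT).
- by apply/negP => H; have := lt' (a + b).+1; rewrite mem_cat H eab ltnn => /(_ isT).
have aj := max_jump_cond jLR; rewrite sL in aj.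
have aj' := max_jump_cond jLR'; rewrite sL' in aj'.
move=> eL eR.
have eaa : a = a' by have := congr1 size eL; rewrite !size_map sL sL'.
clear sL'; subst a'; have ejj : j = j'.
  (* An empty left block forces both jumps to be 0. *)
  case: (posnP a) => [a0|a0]; first by lia.
  have aL : a \in L by rewrite (perm_mem La) mem_iota; lia.
  have aL' : a \in L' by rewrite (perm_mem La') mem_iota; lia.
  have := map_f (left_relabel a j) aL; have := map_f (left_relabel a j') aL'.
  rewrite eL -{1}eL => /mapP[x xL ex] /mapP[y yL ey].
  move: ex ey; have := bL _ xL; have := bL' _ yL.
  by rewrite /left_relabel ltnn; clear; do 2!case: ifP; lia.
subst j'; split=> //.
  by apply: inj_map eL; apply: mono_ltn_inj (left_relabel_mono a j).
by apply: inj_map eR; apply: mono_ltn_inj (right_relabel_mono aj).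
Qed.

(** Once 1 ... j is known to open [v], a next entry other than j + 1 would be larger than j + 1 and
    precede it, which the hypothesis forbids. *)
Lemma prefix_iota_of_no_drop (b j : nat) (v : seq nat) :
  perm_eq v (iota 1 b) -> j <= b ->
  (forall u z t, v = u ++ z :: t -> z <= j -> count (ltn z) u = 0) ->
  prefix (iota 1 j) v.
Proof.
move=> vb jb H; elim: j jb H => [|j IHj] jb H; first exact: prefix0s.
have /perm_iotaP[uv sv bv] := vb.
have /prefixP[t vE] : prefix (iota 1 j) v.
  by apply: IHj => [|u z t vE zj]; [lia | apply: (H _ _ _ vE); lia].
have jv : j.+1 \in v by rewrite (perm_mem vb) mem_iota; lia.
have jt : j.+1 \in t.
  by move: jv; rewrite vE mem_cat mem_iota add1n ltnn andbF.
case: t vE jt => // h t vE jt.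
have [hj|hj] := eqVneq h j.+1.
  by rewrite vE hj -cat_rcons -iota1_rcons prefix_prefix.
move: jt; rewrite inE eq_sym (negbTE hj) /= => jt; exfalso.
have hgt : j.+1 < h.
  have hv : h \in v by rewrite vE mem_cat mem_head orbT.
  have h0 : 0 < h by have := bv _ hv; lia.
  have : h \notin iota 1 j.
    by move: uv; rewrite vE uniq_catC /= mem_cat negb_or => /andP[/andP[]].
  by rewrite mem_iota; move: hj => /eqP; lia.
case/splitPr: jt vE => t1 t2 vE.
have := H (iota 1 j ++ h :: t1) j.+1 t2; rewrite vE -catA => /(_ erefl (leqnn _)).
by rewrite count_cat /= hgt; lia.
Qed.

(** Goodness confines all overlap between the two blocks to the left maximum [l]. Counting then
    determines the values of each block, and the relabellings can be inverted. *)
Lemma preimages_split (n : nat) (w : seq nat) : w \in preimages n.+1 ->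
  exists a b L R j, [/\ a + b = n, L \in preimages a, R \in preimages b,
    j <= max_jump L R & w = join L R j].
Proof.
case/preimagesP => wn gw.
have mw : n.+1 \in w by rewrite (perm_mem wn) mem_iota; lia.
case/splitPr: mw wn gw => L' R'; rewrite perm_iotaS_mid => LRn.
have /perm_iotaP[uLR sLR bLR] := LRn.
rewrite stack_sort_cat; last by apply/allP => x /bLR; lia.
rewrite catA => /good_catl gLR.
have bL x : x \in L' -> 0 < x <= n by move=> xL; apply: bLR; rewrite mem_cat xL.
have bR x : x \in R' -> 0 < x <= n by move=> xR; apply: bLR; rewrite mem_cat xR orbT.
move: sLR; rewrite size_cat => sLR.
case: L' => [|x0 L'] in LRn uLR sLR bLR gLR bL *.
  (* With an empty left block, [right_relabel 0 0] fixes every positive entry, so [R'] is already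
     normalized. *)
  exists 0, n, [::], R', 0; split=> //; first by apply/preimagesP; split.
  have sR : size R' = n := sLR; rewrite /join /= add0n sR; congr (_ :: _).
  by rewrite -[LHS]map_id; apply/eq_in_map => x /bR; rewrite /right_relabel; case: ifP; lia.
have L0 : 0 < size (x0 :: L') by [].
move: (x0 :: L') LRn uLR sLR bLR gLR bL L0 => {x0}L' LRn uLR sLR bLR gLR bL L0.
move: uLR; rewrite cat_uniq => /and3P[uL /hasPn LRdis uR].
set a := size L' in L0 sLR; set b := size R' in sLR.
have [l lL lmax] : exists2 l, l \in L' & {in L', forall x, x <= l}.
  exists (\max_(x <- L') x); first by apply: max_mem; rewrite -size_eq0 -lt0n.
  by move=> x xL; rewrite (big_rem x) //= leq_maxl.
(* Otherwise [x] and [l] would be two larger entries before [y] in the image. *)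
have below x y : x \in L' -> x != l -> y \in R' -> x < y.
  move=> xL xl yR; rewrite ltnNge; apply/negP => yx.
  have yx' : y < x by rewrite ltn_neqAle yx andbT; apply: contraNneq (LRdis _ yR) => ->.
  have ys : y \in stack_sort R' by rewrite (perm_mem (perm_stack_sort _)).
  move: (gLR); case/splitPr: ys => r1 r2 /goodP/(_ (stack_sort L' ++ r1) y r2).
  rewrite catA => /(_ erefl); rewrite count_cat.
  have : 2 <= count (ltn y) (stack_sort L').
    rewrite -size_filter; apply: (@uniq_leq_size _ [:: x; l]); first by rewrite /= inE xl.
    move=> z; rewrite !inE mem_filter (perm_mem (perm_stack_sort _)) /=.
    case/orP=> /eqP->; first by rewrite yx'.
    by rewrite lL andbT (leq_trans yx') // lmax.
  by lia.
have srem : size (rem l L') = a.-1 by rewrite size_rem.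
(* All of 1, ..., x lie in the left block without [l], which has a - 1 elements. *)
have small x : x \in L' -> x != l -> x < a.
  move=> xL xl; suff : size (iota 1 x) <= size (rem l L') by rewrite size_iota srem; lia.
  apply: uniq_leq_size; first exact: iota_uniq.
  move=> z; rewrite mem_iota => zx; rewrite mem_rem_uniq // inE.
  have := bL _ xL => xn; have : z \in L' ++ R' by rewrite (perm_mem LRn) mem_iota; lia.
  rewrite mem_cat => /orP[zL|/(below _ _ xL xl)]; last by lia.
  by rewrite zL andbT; have := lmax _ xL; move/eqP: xl; lia.
have al : a <= l.
  rewrite -(size_iota 1 l); apply: uniq_leq_size => // x xL.
  by have := lmax _ xL; have := bL _ xL; rewrite mem_iota; lia.
(* A right value below [a] would join the a - 1 left values other than [l] among 1, ..., a - 1. *)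
have large y : y \in R' -> a <= y.
  move=> yR; rewrite leqNgt; apply/negP => ya.
  suff : size (y :: rem l L') <= size (iota 1 a.-1) by rewrite /= srem size_iota; lia.
  apply: uniq_leq_size => /=.
    rewrite rem_uniq // andbT; apply: contra (LRdis _ yR); exact: mem_rem.
  move=> z; rewrite mem_iota inE => /predU1P[->|]; first by have := bR _ yR; lia.
  rewrite mem_rem_uniq // inE => /andP[/= zl zL].
  by have := small _ zL zl; have := bL _ zL; lia.
have neql y : y \in R' -> y != l by move=> yR; apply: contraNneq (LRdis _ yR) => ->.
have ln := bL _ lL.
(* The only left value to change is [l], lowered to [a]; on the right, [R] closes the gap at [l]. *)
pose j := l - a; pose L := map (minn^~ a) L'.
pose R := map (fun y => if y < l then y - a.-1 else y - a) R'.
have LE : map (left_relabel a j) L = L'.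
  rewrite -[RHS]map_id -map_comp; apply/eq_in_map => x xL /=; rewrite /left_relabel.
  have [->|xl] := eqVneq x l; first by rewrite (minn_idPr al) ltnn /j; lia.
  by have := small _ xL xl => xa; rewrite (minn_idPl (ltnW xa)) xa.
have RE : map (right_relabel a j) R = R'.
  rewrite -[RHS]map_id -map_comp; apply/eq_in_map => y yR /=; rewrite /right_relabel /j.
  by have := large _ yR; have /eqP := neql _ yR; case: (ltnP y l) => ?; case: ifP; lia.
have aj : (0 < a) || (j == 0) by rewrite L0.
have Lp : perm_eq L (iota 1 a).
  apply/perm_iotaP; rewrite size_map; split=> //.
    by move: uL; rewrite -{1}LE => /map_uniq.
  by move=> _ /mapP[x /bL xL ->]; lia.
have Rp : perm_eq R (iota 1 b).
  apply/perm_iotaP; rewrite size_map; split=> //.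
    by move: uR; rewrite -{1}RE => /map_uniq.
  move=> _ /mapP[y yR ->]; have := bR _ yR; have := large _ yR; have /eqP := neql _ yR.
  by case: ifP; lia.
have /perm_iotaP[uL' _ _] := Lp; have /perm_iotaP[uR' _ _] := Rp.
have sLE : stack_sort L' = map (left_relabel a j) (stack_sort L).
  by rewrite -LE stack_sort_map //; exact: left_relabel_mono.
have sRE : stack_sort R' = map (right_relabel a j) (stack_sort R).
  by rewrite -RE stack_sort_map //; exact: right_relabel_mono.
have sL : size L = a by rewrite size_map.
have sR : size R = b by rewrite size_map.
exists a, b, L, R, j; split=> //.
- apply/preimagesP; split=> //; move/good_catl: gLR; rewrite sLE good_map //.
  exact: left_relabel_mono.
- apply/preimagesP; split=> //; move/good_catr: gLR; rewrite sRE good_map //.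
  exact: right_relabel_mono.
- have -> : max_jump L R = lead R by move: sL L0; rewrite /max_jump; case: (L) => //= <-.
  rewrite /lead fix_run_iota; apply: (prefix_iota_of_no_drop (stack_sort_iota Rp)).
    by rewrite /j; lia.
  move=> u z t vE zj; move/goodP: gLR.
  move=> /(_ (stack_sort L' ++ map (right_relabel a j) u) (right_relabel a j z)).
  move=> /(_ (map (right_relabel a j) t)).
  rewrite sRE vE map_cat /= catA => /(_ erefl); rewrite count_cat count_map.
  rewrite (@eq_count _ (preim _ _) (ltn z)); last first.
    by move=> x /=; rewrite right_relabel_mono.
  (* The entry [l] uses up the one larger predecessor allowed, so [u] contains none. *)
  have : 0 < count (ltn (right_relabel a j z)) (stack_sort L').
    rewrite -has_count; apply/hasP; exists l; first by rewrite (perm_mem (perm_stack_sort _)).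
    by rewrite /= /right_relabel zj; move: zj; rewrite /j; lia.
  by lia.
- by rewrite /join sL sR LE RE sLR.
Qed.

(** * Recurrences *)

Definition joins (n : nat) : seq (seq nat) :=
  [seq join t.1 t.2 j
     | t <- [seq (L, R) | L <- [seq w | a <- iota 0 n.+1, w <- preimages a],
                          R <- preimages (n - size L)],
       j <- iota 0 (max_jump t.1 t.2).+1].

Lemma joins_index (n : nat) (L R : seq nat) :
  (L, R) \in [seq (L, R) | L <- [seq w | a <- iota 0 n.+1, w <- preimages a],
                           R <- preimages (n - size L)] ->
  [/\ size L <= n, L \in preimages (size L) & R \in preimages (n - size L)].
Proof.
case/allpairsPdep=> L0 [R0 [/allpairsPdep[a [w [+ wa ->]]] + [-> ->]]].
by rewrite mem_iota (size_preimages wa) add0n ltnS => an Rn; split.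
Qed.

Lemma joins_uniq (n : nat) : uniq (joins n).
Proof.
apply: allpairs_uniq_dep.
- apply: allpairs_uniq_dep.
  + apply: allpairs_uniq_dep; first exact: iota_uniq.
      by move=> a _; rewrite filter_uniq ?permutations_uniq.
    move=> _ _ /allpairsPdep[a [w [_ wa ->]]] /allpairsPdep[a' [w' [_ wa' ->]]] /= e.
    by move: wa'; rewrite -e => /size_preimages; rewrite (size_preimages wa) => <-.
  + by move=> L _; rewrite filter_uniq ?permutations_uniq.
  + by move=> [L R] [L' R'] _ _ /= [-> ->].
- by move=> t _; exact: iota_uniq.
move=> _ _ /allpairsPdep[[L R] [j [LR jLR ->]]] /allpairsPdep[[L' R'] [j' [LR' jLR' ->]]] /=.
move: jLR jLR'; rewrite !mem_iota !add0n !ltnS /= => jLR jLR'.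
have [Ln /preimagesP[La _] /preimagesP[Rb _]] := joins_index LR.
have [Ln' /preimagesP[La' _] /preimagesP[Rb' _]] := joins_index LR'.
by case/(join_inj La Rb jLR La' Rb' jLR'); [rewrite !subnKC | move=> -> -> ->].
Qed.

Lemma preimagesS (n : nat) : perm_eq (preimages n.+1) (joins n).
Proof.
apply: uniq_perm; rewrite ?joins_uniq ?filter_uniq ?permutations_uniq // => w.
apply/idP/idP => [/preimages_split[a [b [L [R [j [abn La Rb jLR ->]]]]]]|].
  apply/allpairsPdep; exists (L, R), j; split=> //; last first.
    by rewrite mem_iota.
  apply/allpairsPdep; exists L, R; split=> //; last first.
    by rewrite (size_preimages La) -abn addKn.
  by apply/allpairsPdep; exists a, L; split=> //; rewrite mem_iota; lia.
case/allpairsPdep=> [[L R] [j [LR]]]; rewrite mem_iota /= add0n ltnS => jLR ->.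
have [Ln /preimagesP[La gL] /preimagesP[Rb gR]] := joins_index LR.
apply/preimagesP; rewrite -{1}(subnKC Ln); split; first exact: perm_join.
exact: good_join La Rb jLR gL gR.
Qed.

(** The three recurrences below arise by taking [g] to be 1, [(lead w).+1], and the indicator of
    [lead w == n.+1]. *)
Lemma sum_preimagesS (n : nat) (g : seq nat -> nat) :
  \sum_(w <- preimages n.+1) g w =
  \sum_(a < n.+1) \sum_(L <- preimages a) \sum_(R <- preimages (n - a))
    \sum_(j < (max_jump L R).+1) g (join L R j).
Proof.
rewrite (perm_big _ (preimagesS n)) /= big_allpairs_dep big_allpairs_dep big_allpairs_dep.
rewrite -[iota 0 n.+1]/(index_iota 0 n.+1) big_mkord; apply: eq_bigr => a _.
apply: eq_big_seq => L La; rewrite (size_preimages La).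
by apply: eq_bigr => R _; rewrite -[iota 0 _]/(index_iota 0 (max_jump L R).+1) big_mkord.
Qed.

(** The summand is the number of jumps available when [w] stands to the right of a nonempty left
    block. *)
Definition weight (n : nat) : nat := \sum_(w <- preimages n) (lead w).+1.

(** A run of length [n] means that the image is the identity. The identity is good, so every
    permutation sorted by [stack_sort] is counted. *)
Definition sortable (n : nat) : nat := \sum_(w <- preimages n) (lead w == n).

Lemma preimages0 : preimages 0 = [:: [::]].
Proof. by []. Qed.

Lemma sum_mulr_pair (n : nat) (g h : seq nat -> nat) (a : nat) :
  \sum_(L <- preimages a) \sum_(R <- preimages n) g L * h R =
  (\sum_(L <- preimages a) g L) * \sum_(R <- preimages n) h R.
Proof. by rewrite big_distrl /=; apply: eq_bigr => L _; rewrite big_distrr. Qed.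

(** An empty left block allows only [j = 0] and contributes [size (preimages n)], whereas the
    product sum gives it [weight n]. Adding [weight n] on the left avoids subtraction in [nat]. *)
Lemma size_preimagesS (n : nat) :
  size (preimages n.+1) + weight n =
  \sum_(a < n.+1) size (preimages a) * weight (n - a) + size (preimages n).
Proof.
rewrite -[size (preimages n.+1)]sum1_size sum_preimagesS !big_ord_recl.
rewrite preimages0 big_seq1 subn0 mul1n.
under eq_bigr do rewrite /= big_ord1.
rewrite sum1_size /= addnC -!addnA; congr (_ + _); rewrite addnC; congr (_ + _).
apply: eq_bigr => a _; rewrite -sum1_size -sum_mulr_pair.
apply: eq_big_seq => L /size_preimages; case: L => // x L _.
by apply: eq_bigr => R _; rewrite sum1_card card_ord mul1n.
Qed.

(** For unsorted [L] all [(lead R).+1] terms equal [(lead L).+1]. For sorted [L] the term [j = 0] is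
    a + [lead R] + 1, plus 1 if [R] is sorted, and each positive jump gives [a]. When [L] is empty
    there are no positive jumps, but these would add 0, so the formula persists. *)
Lemma sum_lead_join (n : nat) (L R : seq nat) (a : nat) : a <= n ->
  L \in preimages a -> R \in preimages (n - a) ->
  \sum_(j < (max_jump L R).+1) (lead (join L R j)).+1 =
  (lead L).+1 * (lead R).+1 + (lead L == a) * (lead R == n - a).
Proof.
move=> an La Rb; have sL := size_preimages La; have := lead_leq L; rewrite sL.
case/preimagesP: La => La _; case/preimagesP: Rb => Rb _ leL.
rewrite big_ord_recl (lead_join La Rb) //=.
under eq_bigr => j _ do rewrite (lead_join La Rb) //=.
rewrite sum_nat_const card_ord; case: eqP => [->|ne].
  rewrite /max_jump; case: L sL {La leL} => [<-|x L <-] /=; nia.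
rewrite /max_jump; case: L sL leL ne {La} => [<-|x L <-] /=; nia.
Qed.

Lemma weightS (n : nat) :
  weight n.+1 = \sum_(a < n.+1) weight a * weight (n - a) +
                \sum_(a < n.+1) sortable a * sortable (n - a).
Proof.
rewrite /weight sum_preimagesS -big_split; apply: eq_bigr => a _ /=.
rewrite -!sum_mulr_pair -big_split; apply: eq_big_seq => L La /=.
rewrite -big_split; apply: eq_big_seq => R Rb /=.
by rewrite (sum_lead_join (leq_ord a) La Rb).
Qed.

(** A positive jump displaces the left maximum, so the image is sorted only for [j = 0] with both
    blocks sorted. This is the Catalan recurrence. *)
Lemma sortableS (n : nat) :
  sortable n.+1 = \sum_(a < n.+1) sortable a * sortable (n - a).
Proof.
rewrite /sortable sum_preimagesS; apply: eq_bigr => a _ /=.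
rewrite -!sum_mulr_pair; apply: eq_big_seq => L La /=.
apply: eq_big_seq => R Rb /=.
have sL := size_preimages La; have := lead_leq L; rewrite sL.
have := lead_leq R; rewrite (size_preimages Rb).
case/preimagesP: La => La _; case/preimagesP: Rb => Rb _ leR leL.
rewrite big_ord_recl (lead_join La Rb) //=.
rewrite big1 => [|j _]; last first.
  rewrite (lead_join La Rb) //=; have := ltn_ord a.
  by case: (lead L =P a) => ?; case: eqP; lia.
by have := ltn_ord a; case: (lead L =P a) => ?; case: (lead R =P n - a) => ? /=; lia.
Qed.

(** * Generating functions *)

Local Open Scope ring_scope.

Section PowerSeries.

Variable F : fieldType.
Implicit Types f g h : fps F.

Lemma fps_coefXM0 f : (fps_X * f) 0%N = 0.
Proof. by rewrite /= big_ord1 /= mul0r. Qed.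

Lemma fps_coefXMS f n : (fps_X * f) n.+1 = f n.
Proof.
rewrite [LHS]/= 2!big_ord_recl /= mul0r add0r mul1r subSS subn0 big1 ?addr0 //.
by move=> i _; rewrite mul0r.
Qed.

Lemma fps_unit1B f : 1 - fps_X * f \is a GRing.unit.
Proof.
change ((1 - fps_X * f) 0%N != 0).
by rewrite [X in X != _](_ : _ = 1 - (fps_X * f) 0%N) // fps_coefXM0 subr0 oner_eq0.
Qed.

(** Subtracting the equations gives (f - g)(1 - x q (f + g)) = 0, and the second factor is a
    unit. *)
Lemma fps_quadratic_uniq p q f g :
  f = p + fps_X * q * f ^+ 2 -> g = p + fps_X * q * g ^+ 2 -> f = g.
Proof.
move=> ef eg; apply/eqP; rewrite -subr_eq0; apply/eqP.
apply: (mulIr (fps_unit1B (q * (f + g)))); rewrite mul0r.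
transitivity ((f - fps_X * q * f ^+ 2) - (g - fps_X * q * g ^+ 2)); first by ring.
have -> : f - fps_X * q * f ^+ 2 = p by rewrite {1}ef addrK.
have -> : g - fps_X * q * g ^+ 2 = p by rewrite {1}eg addrK.
by rewrite subrr.
Qed.

(** * Composition of power series *)

Lemma fps_exp_low g k n : g 0%N = 0 -> (n < k)%N -> (g ^+ k) n = 0.
Proof.
move=> g0; elim: k n => // k IHk n nk; rewrite exprS /=; apply: big1 => i _.
case: (posnP i) => [->|i0]; first by rewrite g0 mul0r.
by rewrite IHk ?mulr0 //; have := ltn_ord i; lia.
Qed.

Lemma fps_compE f g n N : g 0%N = 0 -> (n < N)%N ->
  fps_comp f g n = \sum_(k < N) f k * (g ^+ k) n.
Proof.
move=> g0 nN; rewrite /= (big_ord_widen N (fun k => f k * (g ^+ k) n)) // big_mkcond /=.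
by apply: eq_bigr => k _; case: ltnP => // nk; rewrite fps_exp_low ?mulr0.
Qed.

Lemma fps_compD f h g : fps_comp (f + h) g = fps_comp f g + fps_comp h g.
Proof. by apply: fpsP => n /=; rewrite -big_split; apply: eq_bigr => k _; rewrite mulrDl. Qed.

Lemma fps_comp1 g : fps_comp 1 g = 1.
Proof.
apply: fpsP => n; rewrite /= big_ord_recl /= mul1r big1 ?addr0 // => k _.
by rewrite mul0r.
Qed.

Lemma fps_compX g : g 0%N = 0 -> fps_comp fps_X g = g.
Proof.
move=> g0; apply: fpsP => n; rewrite (@fps_compE _ _ _ n.+2) //.
rewrite 2!big_ord_recl /= mul0r add0r mul1r expr1 big1 ?addr0 // => k _.
by rewrite mul0r.
Qed.

(** Both sides are compared with the square sum of the terms [T k l] over [k, l < N]. *)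
Lemma fps_compM f h g : g 0%N = 0 ->
  fps_comp (f * h) g = fps_comp f g * fps_comp h g.
Proof.
move=> g0; apply: fpsP => n; pose N := n.+1.
pose T k l := f k * h l * (g ^+ (k + l)) n.
transitivity (\sum_(k < N) \sum_(l < N) T k l); last first.
  transitivity (\sum_(i < N) (\sum_(k < N) f k * (g ^+ k) i) *
                             (\sum_(l < N) h l * (g ^+ l) (n - i)%N)); last first.
    apply: eq_bigr => i _; by rewrite -!fps_compE // ltnS leq_subr.
  under [RHS]eq_bigr => i _.
    rewrite big_distrl /=; under eq_bigr do rewrite big_distrr /=.
    over.
  rewrite [RHS]exchange_big /=; apply: eq_bigr => k _.
  rewrite [RHS]exchange_big /=; apply: eq_bigr => l _.
  rewrite /T exprD /= big_distrr /=; apply: eq_bigr => i _.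
  by rewrite mulrACA.
transitivity (\sum_(m < N) \sum_(k < N | (k <= m)%N) T k (m - k)%N).
  apply: eq_bigr => m _; rewrite big_distrl /=.
  rewrite (big_ord_widen N (fun k => f k * h (m - k)%N * (g ^+ m) n)) //.
  by apply: eq_bigr => k km; rewrite /T subnKC.
rewrite (exchange_big_dep predT) //=; apply: eq_bigr => k _.
(* Terms with [k + l >= N] vanish because [g ^+ (k + l)] starts beyond degree [n]; the rest are
   reindexed by m = k + l. *)
rewrite [RHS](bigID (fun l : 'I_N => (k + l < N)%N)) /= [X in _ = _ + X]big1 ?addr0; last first.
  by move=> l; rewrite -leqNgt => kl; rewrite /T fps_exp_low ?mulr0.
rewrite -(big_mkord (fun m => (k <= m)%N) (fun m => T k (m - k)%N)).
rewrite -(big_mkord (fun l => (k + l < N)%N) (fun l => T k l)).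
transitivity (\sum_(0 + k <= m < N) T k (m - k)%N).
  by rewrite [RHS](@big_nat_widenl _ _ _ _ 0%N).
rewrite big_addn.
rewrite (big_nat_widen _ _ _ _ _ (leq_subr k N)) /=.
by apply: eq_big => l; rewrite ?addnK // -ltn_subRL.
Qed.

End PowerSeries.

(** Expanding the square root relation gives 4 x D = 0 for the difference D of the two sides; x is
    cancelled by a shift of coefficients and 4 in the rationals. *)
Lemma catalan_gf_eq : catalan_gf = 1 + fps_X * catalan_gf ^+ 2.
Proof.
have /eqP := catalan_gf_sqrt; rewrite -subr_eq0 => /eqP e.
pose D := 1 + fps_X * catalan_gf ^+ 2 - catalan_gf.
suff D0 : D = 0 by apply/esym/eqP; rewrite -subr_eq0 -/D D0.
have e4 : fps_X * (D + D + D + D) = 0 by rewrite -[RHS]e /D; ring.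
apply: fpsP => n; change (D n = 0).
have : D n + D n + D n + D n = 0.
  by rewrite -[LHS]/((D + D + D + D) n) -fps_coefXMS e4.
by move: (D n) => x; lra.
Qed.

Lemma fps_comp_catalan (g : fps rat) : g 0%N = 0 ->
  fps_comp catalan_gf g = 1 + g * fps_comp catalan_gf g ^+ 2.
Proof.
move=> g0; rewrite {1}catalan_gf_eq fps_compD fps_comp1 expr2 !fps_compM //.
by rewrite fps_compX // expr2.
Qed.

Lemma size_preimages_card (n : nat) :
  #|` fset_set (stack_sort_preimage (Av n [:: [:: 2; 3; 1]; [:: 3; 2; 1]]%N))|%fset =
  size (preimages n).
Proof.
have -> : stack_sort_preimage (Av n [:: [:: 2; 3; 1]; [:: 3; 2; 1]]%N) =
    [set` preimages n]%classic.
  apply/seteqP; split=> w /=.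
    case=> _ wA; apply/preimagesP.
    have wn : perm_eq (stack_sort w) (iota 1 n) by case: wA.
    by rewrite -(permPl (perm_stack_sort w)); split=> //; exact: (iffLR (Av_good wn)).
  case/preimagesP => wn gw; split; last exact: (iffRL (Av_good (stack_sort_iota wn))).
  have /perm_iotaP[uw _ bw] := wn; rewrite /is_permutation uw /=.
  by apply/negP => /bw.
have -> : [set` preimages n]%classic = [set` [fset w in preimages n]%fset]%classic.
  by apply/seteqP; split=> w /=; rewrite inE.
by rewrite set_fsetK card_fseq undup_id // filter_uniq ?permutations_uniq.
Qed.

Local Open Scope fset_scope.
Local Open Scope ring_scope.

Theorem theorem3p1 :
  (Fps (fun n : nat =>
     #|` fset_set (stack_sort_preimage
           (Av n [:: [:: 2; 3; 1]; [:: 3; 2; 1]]%N))|%:R) : fps rat)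
  = 1 / (1 - fps_X * fps_comp catalan_gf (fps_X * catalan_gf)) :> fps rat.
Proof.
set C := catalan_gf; set G := fps_comp C _.
pose f : fps rat := Fps (fun n => (size (preimages n))%:R).
pose h : fps rat := Fps (fun n => (weight n)%:R).
pose c : fps rat := Fps (fun n => (sortable n)%:R).
set s := (X in X = _); have -> : s = f.
  by apply: fpsP => n; rewrite /s /= size_preimages_card.
have coefM (u v : nat -> nat) (n : nat) :
    (\sum_(a < n.+1) u a * v (n - a))%N%:R =
    ((Fps (fun n => (u n)%:R) : fps rat) * Fps (fun n => (v n)%:R)) n.
  by rewrite natr_sum /=; apply: eq_bigr => a _; rewrite natrM.
have cE : c = 1 + fps_X * 1 * c ^+ 2.
  rewrite mulr1 expr2; apply: fpsP => -[|n].
    by rewrite [RHS]/= big_ord1 /= mul0r addr0 /sortable preimages0 big_seq1.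
  transitivity (0 + (fps_X * (c * c)) n.+1) => //.
  by rewrite fps_coefXMS add0r -coefM -sortableS.
have cC : c = C by apply: (fps_quadratic_uniq cE); rewrite mulr1 -catalan_gf_eq.
have hE : h = C + fps_X * 1 * h ^+ 2.
  rewrite mulr1 expr2 -cC; apply: fpsP => -[|n].
    by rewrite [RHS]/= big_ord1 /= mul0r addr0 /weight /sortable preimages0 !big_seq1.
  transitivity (c n.+1 + (fps_X * (h * h)) n.+1) => //.
  by rewrite fps_coefXMS -coefM /= weightS natrD addrC sortableS.
have GE : G = 1 + fps_X * C * G ^+ 2 by apply: fps_comp_catalan; exact: fps_coefXM0.
(* C G solves the equation of [h]: C + x (C G)^2 = C (1 + x C G^2) = C G. *)
have hG : h = C * G.
  apply: (fps_quadratic_uniq hE); rewrite {1}GE; ring.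
have fE : f + fps_X * h = 1 + fps_X * (f * h + f).
  apply: fpsP => -[|n].
    by rewrite /= !big_ord1 /= !mul0r.
  transitivity (f n.+1 + (fps_X * h) n.+1) => //.
  transitivity (0 + (fps_X * (f * h + f)) n.+1) => //.
  rewrite !fps_coefXMS add0r; transitivity ((f * h) n + f n) => //.
  by rewrite -coefM /= -!natrD size_preimagesS.
rewrite div1r; apply: (mulIr (fps_unit1B G)); rewrite mulVr ?fps_unit1B //.
(* By [fE], f (1 - x (1 + h)) = 1 - x h. Multiplying by this unit therefore eliminates [f] and
   leaves an identity between [C] and [G], settled by G - x C G^2 = 1. *)
apply: (mulIr (fps_unit1B (1 + h))).
have -> : f * (1 - fps_X * G) * (1 - fps_X * (1 + h)) =
  (1 - fps_X * G) * (f + fps_X * h - fps_X * (f * h + f) - fps_X * h) by ring.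
rewrite fE addrK hG mul1r.
transitivity (1 - fps_X * (C * G) - fps_X * (G - fps_X * C * G ^+ 2)); first by ring.
by rewrite {2}GE addrK; ring.
Qed.
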